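(* Let $M$ be a connected mixed bipartite graph of order $n$ with underlying graph $M_U$, let $\mu_1\ge\cdots\ge\mu_n$ be the eigenvalues of $R_H(M)$, and $\alpha=\min_{1\le i\le\lfloor n/2\rfloor}|\mu_i|$. Then $$\mathcal{E}_{R_H}(M)\ge2\left(\frac{R_{-1}(M_U)+\lfloor\frac n2\rfloor\alpha\mu_1}{\alpha+\mu_1}\right).$$
   Context: A mixed graph $M$ is obtained from a simple graph $M_U$ by orienting some of its edges; it is a mixed bipartite graph if $M_U$ is bipartite, and connected if $M_U$ is. Degrees $d_k$ are taken in $M_U$. The Hermitian-Randić matrix $R_H(M)$ has $(k,l)$ entry $\frac{1}{\sqrt{d_kd_l}}$ if $v_kv_l$ is an undirected edge, $\frac{\mathrm{i}}{\sqrt{d_kd_l}}$ if $(v_k,v_l)$ is an arc, $\frac{-\mathrm{i}}{\sqrt{d_kd_l}}$ if $(v_l,v_k)$ is an arc, and $0$ otherwise. $\mathcal{E}_{R_H}(M)=\sum_{i=1}^n|\mu_i|$. $R_{-1}(M_U)=\sum_{v_jv_k\in E(M_U)}\frac{1}{d_jd_k}$ over unordered edges. *)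

(* Defs.v *)
From HB Require Import structures.
From mathcomp Require Import all_boot all_order all_algebra.
From mathcomp Require Import complex.

Set Implicit Arguments.
Unset Strict Implicit.
Unset Printing Implicit Defensive.

Import Order.TTheory GRing.Theory Num.Theory.
Local Open Scope ring_scope.

Record simple_graph (n : nat) := SimpleGraph {
  adj : rel 'I_n;
  adj_sym : symmetric adj;
  adj_irrefl : irreflexive adj
}.

Definition deg n (G : simple_graph n) (k : 'I_n) : nat := #|[set l | adj G k l]|.

Definition bipartite n (G : simple_graph n) : Prop :=
  exists A : {set 'I_n}, forall k l, adj G k l -> (k \in A) != (l \in A).

Definition connected n (G : simple_graph n) : Prop :=
  forall k l : 'I_n, connect (adj G) k l.

(* [arc k l] means that the edge kl of the underlying graph is oriented from k
   to l; an edge with neither orientation remains undirected. *)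
Record mixed_graph (n : nat) := MixedGraph {
  underlying : simple_graph n;
  arc : rel 'I_n;
  arc_adj : forall k l, arc k l -> adj underlying k l;
  arc_asym : forall k l, arc k l -> ~~ arc l k
}.

Definition undirected n (M : mixed_graph n) : rel 'I_n :=
  fun k l => [&& adj (underlying M) k l, ~~ arc M k l & ~~ arc M l k].

Definition hermitian_randic (R : rcfType) n (M : mixed_graph n) : 'M[R[i]]_n :=
  \matrix_(k, l)
    let w : R :=
      (Num.sqrt ((deg (underlying M) k)%:R * (deg (underlying M) l)%:R))^-1 in
    if undirected M k l then Complex w 0
    else if arc M k l then Complex 0 w
    else if arc M l k then Complex 0 (- w)
    else 0.

(* Each unordered edge jk is counted once, through its representative j < k. *)
Definition randic_m1 (R : rcfType) n (G : simple_graph n) : R :=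
  \sum_(j < n) \sum_(k < n | (j < k)%N && adj G j k)
    ((deg G j)%:R * (deg G k)%:R)^-1.

(* [mu] lists the eigenvalues of [A], all real, with algebraic multiplicity and
   in nonincreasing order. *)
Definition ordered_spectrum (R : rcfType) n (A : 'M[R[i]]_n) (mu : n.-tuple R) : Prop :=
  char_poly A = \prod_(x <- mu) ('X - (Complex x 0)%:P)
  /\ sorted (fun x y : R => y <= x) mu.

Definition energy (R : rcfType) n (mu : n.-tuple R) : R := \sum_(i < n) `|mu`_i|.

(* Indices start at 0, so the range i < n./2 is the first floor(n/2) eigenvalues.
   When 2 <= n the seed |mu`_0| is itself one of these terms, so this is their
   minimum; for n < 2 the range is empty and the seed is a conventional value. *)
Definition min_abs_half (R : rcfType) n (mu : n.-tuple R) : R :=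
  \big[Num.min/`|mu`_0|]_(i < n./2) `|mu`_i|.

(* Main.v *)
(* Conjugating R_H(M) by the diagonal sign matrix of the bipartition negates it,
   so the spectrum is symmetric: mu_(n+1-i) = - mu_i.  Hence the energy is twice
   the sum of the mu_i with i <= n/2, all nonnegative, and their squares add up
   to tr(R_H(M)^2) / 2 = R_(-1)(M_U).  It remains to sum the inequalities
   (mu_i - alpha) (mu_1 - mu_i) >= 0 over i <= n/2.  The trace of A^2 is read off
   the factorization chi_(A^2)(X^2) = det(X - A) det(X + A). *)
Require Import Defs.
From mathcomp Require Import all_boot all_order all_algebra.
From mathcomp Require Import complex.
From mathcomp Require Import ring lra zify.

Import Order.TTheory GRing.Theory Num.Theory.
Local Open Scope ring_scope.

Lemma char_poly_opp (R : comNzRingType) n (A : 'M[R]_n) :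
  char_poly (- A) = (-1) ^+ n * (char_poly A \Po (- 'X)).
Proof.
rewrite /char_poly -[_ \Po _]det_map_mx -detZ; congr (\det _).
apply/matrixP => i j; rewrite !mxE /= comp_polyB comp_polyC.
by rewrite raddfMn /= comp_polyX polyCN mulN1r mulNrn; ring.
Qed.

Lemma char_poly_sqr (R : comNzRingType) n (A : 'M[R]_n) :
  char_poly (A *m A) \Po 'X^2 = char_poly A * char_poly (- A).
Proof.
rewrite /char_poly -[_ \Po _]det_map_mx -det_mulmx; congr (\det _).
rewrite /char_poly_mx map_mxN opprK mulmxBl !mulmxDr -(scalar_mxC _ (map_mx _ A)).
rewrite -scalar_mxM addrKA -map_mxM.
apply/matrixP => i j; rewrite !mxE /= comp_polyB comp_polyC.
by rewrite raddfMn /= comp_polyX expr2.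
Qed.

Lemma char_poly_opp_prod (R : comNzRingType) n (A : 'M[R]_n) (s : seq R) :
    char_poly A = \prod_(x <- s) ('X - x%:P) ->
  char_poly (- A) = \prod_(x <- s) ('X - (- x)%:P).
Proof.
move=> pA; have sz : size s = n.
  by apply/eqP; rewrite -eqSS -(size_prod_XsubC _ id) -pA size_char_poly.
rewrite char_poly_opp pA rmorph_prod /= -sz.
(* The sign [(-1) ^+ n] is spread over the [n] factors, each of which becomes -(-X - x) = X + x. *)
have -> : (-1) ^+ size s = \prod_(x <- s) (-1) :> {poly R}.
  by rewrite big_const_seq count_predT iter_mulr_1.
rewrite -big_split /=; apply: eq_bigr => x _.
by rewrite comp_polyB comp_polyX comp_polyC polyCN; ring.
Qed.

(** Since (X - x)(X + x) = X^2 - x^2, the squares of the roots of [char_poly A] are the roots of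
    [char_poly (A *m A)], with multiplicity; no diagonalisation of [A] is involved. The trace is
    then minus the coefficient of degree [n.-1]. *)
Lemma mxtrace_sqr_prod (F : fieldType) n (A : 'M[F]_n) (s : seq F) :
    char_poly A = \prod_(x <- s) ('X - x%:P) ->
  \tr (A *m A) = \sum_(x <- s) x ^+ 2.
Proof.
move=> pA; have sz : size s = n.
  by apply/eqP; rewrite -eqSS -(size_prod_XsubC _ id) -pA size_char_poly.
(* For [n = 0] there is no coefficient below the leading one to read the trace from. *)
have [n0|n_gt0] := posnP n.
  have -> : s = [::] by apply: size0nil; rewrite sz.
  by rewrite big_nil; apply: big1 => i; have := ltn_ord i; rewrite [X in (_ < X)%N]n0.
suff pA2 : char_poly (A *m A) = \prod_(x <- [seq x ^+ 2 | x <- s]) ('X - x%:P).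
  apply: oppr_inj; rewrite -char_poly_trace // pA2 -{1}sz.
  by rewrite -(size_map (fun x => x ^+ 2) s)
    coefPn_prod_XsubC ?big_map ?size_map ?sz ?gtn_eqF.
(* Composition with ['X^2] is injective, so the two polynomials may be compared after it. *)
apply/eqP; rewrite -subr_eq0 -(@comp_poly_eq0 _ _ ('X^2)) ?size_polyXn //.
rewrite comp_polyB char_poly_sqr (char_poly_opp_prod _ _ _ _ pA) pA subr_eq0.
rewrite -big_split big_map rmorph_prod /=; apply/eqP/eq_bigr => x _.
by rewrite comp_polyB comp_polyX comp_polyC rmorphXn polyCN /=; ring.
Qed.

Lemma char_poly_opp_bipartite (R : comNzRingType) n (A : 'M[R]_n) (S : {set 'I_n}) :
    (forall k l, (k \in S) = (l \in S) -> A k l = 0) ->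
  char_poly (- A) = char_poly A.
Proof.
move=> A0; pose D : 'M[{poly R}]_n := diag_mx (\row_i (-1) ^+ (i \in S)).
have DD : D *m D = 1%:M.
  rewrite mulmx_diag -diag_const_mx; congr diag_mx.
  by apply/rowP => i; rewrite !mxE -expr2 sqrr_sign.
have -> : char_poly (- A) = \det (D *m char_poly_mx A *m D).
  rewrite /char_poly; congr (\det _); apply/matrixP => i j.
  rewrite mul_mx_diag mul_diag_mx !mxE polyCN.
  (* The hypothesis at [k = l] also kills the diagonal of [A]. Conjugation by [D] fixes the diagonal
     of X - A and flips the sign of the entries linking [S] to its complement. *)
  have [->|ij] := eqVneq i j.
    by rewrite A0 // polyC0 !oppr0 !addr0 mulrAC -expr2 sqrr_sign mul1r.
  have [e|] := eqVneq (i \in S) (j \in S).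
    by rewrite A0 // mulr0n polyC0 !oppr0 !addr0 mulr0 mul0r.
  by case: (i \in S); case: (j \in S) => // _; rewrite mulr0n ?expr1 ?expr0; ring.
by rewrite !det_mulmx mulrAC -det_mulmx DD det1 mul1r.
Qed.

Lemma sum_half (R : nmodType) n (g : nat -> R) :
    (forall i, (i < n)%N -> g (n - i.+1)%N = g i) ->
    (odd n -> g n./2 = 0) ->
  \sum_(i < n) g i = (\sum_(i < n./2) g i) *+ 2.
Proof.
move=> gs g0; rewrite -(big_mkord xpredT) (@big_cat_nat _ _ _ n./2) //=; last by lia.
rewrite mulr2n big_mkord; congr (_ + _).
have [lo eo] : (n./2 <= n - n./2)%N /\ (n - n./2 = n./2 + odd n)%N by lia.
(* The upper range is a middle block of [odd n] terms, which vanishes, followed by the mirror image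
   of the lower range. *)
rewrite (@big_cat_nat _ _ _ (n - n./2)) //=; last by lia.
rewrite [X in X + _](_ : _ = 0) ?add0r; last first.
  rewrite eo; case: (odd n) g0 => [/(_ isT) g0|_].
    by rewrite addn1 big_nat1.
  by rewrite addn0 big_geq.
rewrite -{1}[(n - n./2)%N]add0n big_addn (_ : n - (n - n./2) = n./2)%N; last by lia.
rewrite big_mkord (reindex_inj rev_ord_inj) /=; apply: eq_bigr => i _.
rewrite -gs; last by have := ltn_ord i; lia.
by congr g; have := ltn_ord i; lia.
Qed.

Lemma char_poly_real_complex (R : rcfType) n (A : 'M[R[i]]_n) (mu : n.-tuple R) :
    ordered_spectrum A mu ->
  char_poly A = \prod_(x <- map (real_complex R) mu) ('X - x%:P).
Proof. by move=> [-> _]; rewrite big_map. Qed.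

(** Negating and then reversing a nonincreasing list gives a nonincreasing list. Here it is also a
    permutation of [s], hence [s] itself, because a sorted arrangement is unique. *)
Lemma sorted_ge_opp_sym (R : realDomainType) (s : seq R) i :
    sorted >=%R s -> perm_eq s (map -%R s) -> (i < size s)%N ->
  s`_(size s - i.+1) = - s`_i.
Proof.
move=> s_sorted s_perm lt_i.
have E : s = rev (map -%R s).
  apply: (@sorted_eq _ >=%R) => //.
  - exact/rev_trans/le_trans.
  - by move=> x y; rewrite andbC => /le_anti.
  - rewrite rev_sorted sorted_map.
    by apply: sub_sorted s_sorted => x y; rewrite /= lerN2.
  - by rewrite perm_sym perm_rev perm_sym.
have -> (k : nat) : s`_k = (rev (map -%R s))`_k by rewrite -E.
have lt_j : (size s - i.+1 < size s)%N by rewrite ltn_subrL (leq_ltn_trans _ lt_i).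
by rewrite nth_rev size_map // subnS subKn // (nth_map 0).
Qed.

(** Opposite entries multiply to 1/(d_j d_k) on every edge, oriented or not, because i(-i) = 1 = 1 *
    1. The trace meets each edge once in each direction, hence the factor 2. *)
Lemma mxtrace_hermitian_randic_sqr (R : rcfType) n (M : mixed_graph n) :
  \tr (hermitian_randic R M *m hermitian_randic R M) =
  (2 * randic_m1 R (underlying M))%:C%C.
Proof.
set G := underlying M.
pose f (j k : 'I_n) : R := if adj G j k then ((deg G j)%:R * (deg G k)%:R)^-1 else 0.
have fC j k : f j k = f k j by rewrite /f adj_sym mulrC.
have entry j k : hermitian_randic R M j k * hermitian_randic R M k j = (f j k)%:C%C.
  rewrite !mxE /undirected -/G (adj_sym G k j) /f.
  have [jk|njk] := boolP (adj G j k); last first.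
    have njk' : ~~ adj G k j by rewrite adj_sym.
    rewrite (negPf (contra (@arc_adj _ M j k) njk)).
    by rewrite (negPf (contra (@arc_adj _ M k j) njk')) mul0r.
  rewrite (mulrC (deg G k)%:R).
  have ww (x : R) : 0 <= x -> (Num.sqrt x)^-1 * (Num.sqrt x)^-1 = x^-1.
    by move=> x0; rewrite -invfM -expr2 sqr_sqrtr.
  have := ww _ (mulr_ge0 (ler0n R (deg G j)) (ler0n R (deg G k))).
  move: (Num.sqrt _)^-1 => w {}ww.
  have := @arc_asym _ M j k.
  case: (Defs.arc M j k) => [/(_ isT)/negPf-> /=|_]; last case: (Defs.arc M k j) => /=;
  by rewrite -ww; apply/eqP; rewrite eq_complex /=; apply/andP; split; apply/eqP; ring.
transitivity (\sum_(j < n) \sum_(k < n) (f j k)%:C%C).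
  by apply: eq_bigr => j _; rewrite mxE; apply: eq_bigr => k _.
under eq_bigr => j _ do rewrite -(rmorph_sum (real_complex R)).
rewrite -(rmorph_sum (real_complex R)); congr (_%:C)%C.
(* The diagonal drops out by irreflexivity, and the two triangles agree by the symmetry of [f]. *)
transitivity (\sum_(j < n) \sum_(k < n | (j < k)%N) f j k + \sum_(j < n) \sum_(k < n | (k < j)%N) f j k).
  rewrite -big_split; apply: eq_bigr => j _ /=.
  rewrite (bigID (fun k : 'I_n => (j < k)%N)) /=; congr (_ + _).
  rewrite (bigD1 j) ?ltnn //= {1}/f adj_irrefl add0r.
  apply: eq_bigl => k; rewrite -leqNgt ltn_neqAle andbC; congr (_ && _).
have -> : \sum_(j < n) \sum_(k < n | (k < j)%N) f j k = \sum_(j < n) \sum_(k < n | (j < k)%N) f j k.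
  rewrite (exchange_big_dep xpredT) //=; apply: eq_bigr => j _.
  by apply: eq_bigr => k _.
rewrite mulr_natl mulr2n; congr (_ + _); apply: eq_bigr => j _;
  by rewrite big_mkcondr.
Qed.

Theorem theorem3p13 (R : rcfType) (n : nat) (M : mixed_graph n) (mu : n.-tuple R)
  (M_conn : connected (underlying M))
  (M_bip : bipartite (underlying M))
  (mu_spec : ordered_spectrum (hermitian_randic R M) mu) :
  let alpha := min_abs_half mu in
  energy mu >=
    2 * ((randic_m1 R (underlying M) + (n./2)%:R * alpha * mu`_0) / (alpha + mu`_0)).
Proof.
cbv zeta; set alpha := min_abs_half mu; rewrite /energy.
have pA := char_poly_real_complex _ _ _ _ mu_spec.
have mu_sorted : sorted >=%R mu by case: mu_spec.
have mu_perm : perm_eq mu (map -%R mu).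
  (* A product of monic linear factors determines its roots up to order. This is applied over [R[i]]
     and brought back along the injection of [R]. *)
  apply: (perm_map_inj (@complexI R)); apply: prod_XsubC_eq.
  case: M_bip => S SP; rewrite -pA -(char_poly_opp_bipartite _ _ _ S).
    rewrite (char_poly_opp_prod _ _ _ _ pA) !big_map.
    by apply: eq_bigr => x _; rewrite -(rmorphN (real_complex R)).
  move=> k l kl; have nkl : ~~ adj (underlying M) k l.
    by apply/negP => /SP; rewrite kl eqxx.
  have nlk : ~~ adj (underlying M) l k by rewrite adj_sym.
  rewrite mxE /undirected (negPf nkl) /=.
  rewrite (negPf (contra (@arc_adj _ M k l) nkl)).
  by rewrite (negPf (contra (@arc_adj _ M l k) nlk)).
have mu_sym i : (i < n)%N -> mu`_(n - i.+1) = - mu`_i.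
  move=> lt_i; have := sorted_ge_opp_sym _ _ i mu_sorted mu_perm.
  by rewrite size_tuple => ->.
have mu_le i j : (i <= j < n)%N -> mu`_j <= mu`_i.
  move=> /andP[le_ij lt_j].
  by apply: (sorted_leq_nth (rev_trans le_trans) lexx 0 mu_sorted);
    rewrite ?inE ?size_tuple //; lia.
have mu_mid : odd n -> mu`_n./2 = 0.
  (* For odd [n] the middle index is its own mirror image, so the eigenvalue there equals its
     opposite. *)
  move=> n_odd; have := mu_sym n./2 ltac:(lia).
  rewrite (_ : n - n./2.+1 = n./2)%N; last by lia.
  lra.
have mu_ge0 i : (i < n./2)%N -> 0 <= mu`_i.
  move=> lt_i; have := mu_le i (n - i.+1)%N ltac:(lia).
  rewrite mu_sym; [lra|lia].
have sum_abs : \sum_(i < n) `|mu`_i| = 2 * \sum_(i < n./2) mu`_i.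
  rewrite (sum_half _ _ (fun i => `|mu`_i|)); first last.
  - by move=> /mu_mid ->; rewrite normr0.
  - by move=> i lt_i; rewrite mu_sym // normrN.
  rewrite mulr_natl; congr (_ *+ 2).
  by apply: eq_bigr => i _; rewrite ger0_norm ?mu_ge0.
have sum_sqr : randic_m1 R (underlying M) = \sum_(i < n./2) mu`_i ^+ 2.
  have := mxtrace_sqr_prod _ _ _ _ pA.
  rewrite mxtrace_hermitian_randic_sqr big_map.
  under eq_bigr => x _ do rewrite -rmorphXn.
  rewrite -(rmorph_sum (real_complex R)) => /complexI.
  rewrite (big_nth 0) size_tuple big_mkord.
  rewrite (sum_half _ _ (fun i => mu`_i ^+ 2)); first last.
  - by move=> /mu_mid ->; rewrite expr0n.
  - by move=> i lt_i; rewrite mu_sym // sqrrN.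
  by rewrite mulr_natl => /eqP; rewrite eqrMn2r => /eqP.
have alpha_le i : (i < n./2)%N -> alpha <= mu`_i.
  move=> lt_i; rewrite -[leRHS]ger0_norm ?mu_ge0 //.
  exact: (@bigmin_le _ _ _ _ (Ordinal lt_i) (fun i : 'I_n./2 => `|mu`_i|)).
rewrite sum_abs ler_pM2l ?ltr0n //.
(* For [n < 2] all the sums are empty and both sides are 0, whatever the conventional value of
   [alpha]. *)
have [h0|h_gt0] := posnP n./2.
  by rewrite sum_sqr h0 !big_ord0 mul0r mul0r add0r mul0r.
have alpha_ge0 : 0 <= alpha.
  by rewrite /alpha /min_abs_half; apply: le_bigmin.
(* With a zero denominator the quotient is 0 by convention, and the bound only says that the sum is
   nonnegative. *)
have [s0|s_neq0] := eqVneq (alpha + mu`_0) 0.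
  by rewrite s0 invr0 mulr0; apply: sumr_ge0 => i _; exact: mu_ge0.
rewrite ler_pdivrMr; last by rewrite lt_def s_neq0 addr_ge0 ?mu_ge0.
have -> : (n./2)%:R * alpha * mu`_0 = \sum_(i < n./2) alpha * mu`_0.
  by rewrite sumr_const card_ord -mulrA mulr_natl.
rewrite sum_sqr -big_split mulr_suml; apply: ler_sum => i _ /=.
rewrite -subr_ge0.
have -> : mu`_i * (alpha + mu`_0) - (mu`_i ^+ 2 + alpha * mu`_0) =
          (mu`_i - alpha) * (mu`_0 - mu`_i) by ring.
by rewrite mulr_ge0 // subr_ge0 ?alpha_le // mu_le //; have := ltn_ord i; lia.
Qed.
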